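(* Let $H$ and $H'$ be two crossed homomorphisms from a Lie-Yamaguti algebra $(\mathfrak g,[\cdot,\cdot]_{\mathfrak g},[\![\cdot,\cdot,\cdot]\!]_{\mathfrak g})$ to another Lie-Yamaguti algebra $(\mathfrak h,[\cdot,\cdot]_{\mathfrak h},[\![\cdot,\cdot,\cdot]\!]_{\mathfrak h})$ with respect to an action $(\rho,\mu)$, and let $(\psi_{\mathfrak g},\psi_{\mathfrak h})$ be a homomorphism from $H'$ to $H$ with $\psi_{\mathfrak g}$ invertible. Define $p:\mathfrak C^n_{H'}(\mathfrak g,\mathfrak h)\to\mathfrak C^n_H(\mathfrak g,\mathfrak h)$, $n\geq1$, as follows: for $n\geq 2$ and $(f,g)\in\mathfrak C^n_{H'}(\mathfrak g,\mathfrak h)$, $p(f,g)=(p_{\rm I}(f),p_{\rm II}(g))$ with $$p_{\rm I}(f)(\mathfrak X_1,\dots,\mathfrak X_{n-1})=\psi_{\mathfrak h}\Big(f\big(\psi_{\mathfrak g}^{-1}(\mathfrak X_1),\dots,\psi_{\mathfrak g}^{-1}(\mathfrak X_{n-1})\big)\Big),$$ $$p_{\rm II}(g)(\mathfrak X_1,\dots,\mathfrak X_{n-1},x)=\psi_{\mathfrak h}\Big(g\big(\psi_{\mathfrak g}^{-1}(\mathfrak X_1),\dots,\psi_{\mathfrak g}^{-1}(\mathfrak X_{n-1}),\psi_{\mathfrak g}^{-1}(x)\big)\Big),$$ where $\mathfrak X_k=x_k\wedge y_k\in\wedge^2\mathfrak g$, $x\in\mathfrak g$ and $\psi_{\mathfrak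 g}^{-1}(\mathfrak X_k)=\psi_{\mathfrak g}^{-1}(x_k)\wedge\psi_{\mathfrak g}^{-1}(y_k)$; and for $n=1$, $p(f)(x)=\psi_{\mathfrak h}\big(f(\psi_{\mathfrak g}^{-1}(x))\big)$. Then $p$ is a cochain map from $\big(\bigoplus_{n=1}^\infty\mathfrak C^n_{H'}(\mathfrak g,\mathfrak h),\delta^{H'}\big)$ to $\big(\bigoplus_{n=1}^\infty\mathfrak C^n_{H}(\mathfrak g,\mathfrak h),\delta^{H}\big)$. Consequently, $p$ induces a homomorphism $p_*:\mathcal H^n_{H'}(\mathfrak g,\mathfrak h)\to\mathcal H^n_H(\mathfrak g,\mathfrak h)$ between cohomology groups for $n\ge 1$.
   Context: All vector spaces are finite-dimensional over a field $\mathbb K$ of characteristic $0$. A Lie-Yamaguti algebra is a vector space $\mathfrak g$ with a bilinear bracket $[\cdot,\cdot]:\wedge^2\mathfrak g\to\mathfrak g$ and a trilinear bracket $[\![\cdot,\cdot,\cdot]\!]:\wedge^2\mathfrak g\otimes\mathfrak g\to\mathfrak g$ (skew-symmetric in the first two arguments) such that for all $x,y,z,w,t\in\mathfrak g$: (1) $[[x,y],z]+[[y,z],x]+[[z,x],y]+[\![x,y,z]\!]+[\![y,z,x]\!]+[\![z,x,y]\!]=0$; (2) $[\![[x,y],z,w]\!]+[\![[y,z],x,w]\!]+[\![[z,x],y,w]\!]=0$; (3) $[\![x,y,[z,w]]\!]=[[\![x,y,z]\!],w]+[z,[\![x,y,w]\!]]$; (4) $[\![x,y,[\![z,w,t]\!]]\!]=[\![[\![x,y,z]\!],w,t]\!]+[\![z,[\![x,y,w]\!],t]\!]+[\![z,w,[\![x,y,t]\!]]\!]$.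 A homomorphism of Lie-Yamaguti algebras is a linear map preserving both brackets. A representation of $\mathfrak g$ on a vector space $V$ is a linear map $\rho:\mathfrak g\to\mathfrak{gl}(V)$ and a bilinear map $\mu:\otimes^2\mathfrak g\to\mathfrak{gl}(V)$ such that, with $D(x,y)=D_{\rho,\mu}(x,y):=\mu(y,x)-\mu(x,y)+[\rho(x),\rho(y)]-\rho([x,y])$ (so $D$ is defined on $\wedge^2\mathfrak g$), for all $x,y,z,w\in\mathfrak g$: $\mu([x,y],z)-\mu(x,z)\rho(y)+\mu(y,z)\rho(x)=0$; $\mu(x,[y,z])-\rho(y)\mu(x,z)+\rho(z)\mu(x,y)=0$; $\rho([\![x,y,z]\!])=[D(x,y),\rho(z)]$; $\mu(z,w)\mu(x,y)-\mu(y,w)\mu(x,z)-\mu(x,[\![y,z,w]\!])+D(y,z)\mu(x,w)=0$; $\mu([\![x,y,z]\!],w)+\mu(z,[\![x,y,w]\!])=[D(x,y),\mu(z,w)]$. The center of $\mathfrak h$ is $C(\mathfrak h):=\{u:[u,v]=0\ \forall v\}\cap\big(\{u:[\![u,v,w]\!]=0\ \forall v,w\}\cup\{u:[\![v,u,w]\!]=0\ \forall v,w\}\big)$. An action of $\mathfrak g$ on $\mathfrak h$ is a representation $(\rho,\mu)$ of $\mathfrak g$ on the vector space $\mathfrak h$ such that for all $x,y\in\mathfrak g$, $u,v,w\in\mathfrak h$: $\rho(x)u,\ \mu(x,y)u\in C(\mathfrak h)$; $\rho(x)[u,v]_{\mathfrak h}=\mu(x,y)[u,v]_{\mathfrak h}=0$;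 $\rho(x)[\![u,v,w]\!]_{\mathfrak h}=\mu(x,y)[\![u,v,w]\!]_{\mathfrak h}=0$. A crossed homomorphism from $\mathfrak g$ to $\mathfrak h$ with respect to $(\rho,\mu)$ is a linear map $H:\mathfrak g\to\mathfrak h$ such that for all $x,y,z\in\mathfrak g$: $H[x,y]_{\mathfrak g}=\rho(x)H(y)-\rho(y)H(x)+[Hx,Hy]_{\mathfrak h}$ and $H[\![x,y,z]\!]_{\mathfrak g}=D(x,y)H(z)+\mu(y,z)H(x)-\mu(x,z)H(y)+[\![Hx,Hy,Hz]\!]_{\mathfrak h}$. A homomorphism from a crossed homomorphism $H'$ to a crossed homomorphism $H$ (both with respect to $(\rho,\mu)$) is a pair of Lie-Yamaguti algebra homomorphisms $\psi_{\mathfrak g}:\mathfrak g\to\mathfrak g$, $\psi_{\mathfrak h}:\mathfrak h\to\mathfrak h$ with $\psi_{\mathfrak h}\circ H'=H\circ\psi_{\mathfrak g}$, $\psi_{\mathfrak h}(\rho(x)u)=\rho(\psi_{\mathfrak g}(x))\psi_{\mathfrak h}(u)$, $\psi_{\mathfrak h}(\mu(x,y)u)=\mu(\psi_{\mathfrak g}(x),\psi_{\mathfrak g}(y))\psi_{\mathfrak h}(u)$ for all $x,y\in\mathfrak g$, $u\in\mathfrak h$. Yamaguti cochains with coefficients in a representation $(V;\rho,\mu)$: $C^1_{\rm LieY}(\mathfrak g,V)=\mathrm{Hom}(\mathfrak g,V)$, and for $n\ge1$, $C^{n+1}_{\rm LieY}(\mathfrak g,V)=\mathrm{Hom}((\wedge^2\mathfrak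 g)^{\otimes n},V)\times\mathrm{Hom}((\wedge^2\mathfrak g)^{\otimes n}\otimes\mathfrak g,V)$. For $f\in C^1_{\rm LieY}$, $\delta f=(\delta_{\rm I}f,\delta_{\rm II}f)$ with $\delta_{\rm I}(f)(x,y)=\rho(x)f(y)-\rho(y)f(x)-f([x,y])$, $\delta_{\rm II}(f)(x,y,z)=D(x,y)f(z)+\mu(y,z)f(x)-\mu(x,z)f(y)-f([\![x,y,z]\!])$. For $n\geq1$ and $(f,g)\in C^{n+1}_{\rm LieY}$, $\delta(f,g)=(\delta_{\rm I}(f,g),\delta_{\rm II}(f,g))\in C^{n+2}_{\rm LieY}$ where, with $\mathfrak X_i=x_i\wedge y_i$ and $\mathfrak X_k\circ\mathfrak X_l:=[\![x_k,y_k,x_l]\!]\wedge y_l+x_l\wedge[\![x_k,y_k,y_l]\!]$ (placed in the position of $\mathfrak X_l$), $$\delta_{\rm I}(f,g)(\mathfrak X_1,\dots,\mathfrak X_{n+1})=(-1)^n\big(\rho(x_{n+1})g(\mathfrak X_1,\dots,\mathfrak X_n,y_{n+1})-\rho(y_{n+1})g(\mathfrak X_1,\dots,\mathfrak X_n,x_{n+1})-g(\mathfrak X_1,\dots,\mathfrak X_n,[x_{n+1},y_{n+1}])\big)$$ $$+\sum_{k=1}^n(-1)^{k+1}D(\mathfrak X_k)f(\mathfrak X_1,\dots,\widehat{\mathfrak X_k},\dots,\mathfrak X_{n+1})+\sum_{1\le k<l\le n+1}(-1)^kf(\mathfrak X_1,\dots,\widehat{\mathfrak X_k},\dots,\mathfrak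 X_k\circ\mathfrak X_l,\dots,\mathfrak X_{n+1}),$$ $$\delta_{\rm II}(f,g)(\mathfrak X_1,\dots,\mathfrak X_{n+1},z)=(-1)^n\big(\mu(y_{n+1},z)g(\mathfrak X_1,\dots,\mathfrak X_n,x_{n+1})-\mu(x_{n+1},z)g(\mathfrak X_1,\dots,\mathfrak X_n,y_{n+1})\big)$$ $$+\sum_{k=1}^{n+1}(-1)^{k+1}D(\mathfrak X_k)g(\mathfrak X_1,\dots,\widehat{\mathfrak X_k},\dots,\mathfrak X_{n+1},z)+\sum_{1\le k<l\le n+1}(-1)^kg(\mathfrak X_1,\dots,\widehat{\mathfrak X_k},\dots,\mathfrak X_k\circ\mathfrak X_l,\dots,\mathfrak X_{n+1},z)$$ $$+\sum_{k=1}^{n+1}(-1)^kg(\mathfrak X_1,\dots,\widehat{\mathfrak X_k},\dots,\mathfrak X_{n+1},[\![x_k,y_k,z]\!]).$$ Cohomology of a crossed homomorphism $H$: $(\mathfrak h;\rho_H,\mu_H)$ with $\rho_H(x)u=[Hx,u]_{\mathfrak h}+\rho(x)u$, $\mu_H(x,y)u=[\![u,Hx,Hy]\!]_{\mathfrak h}+\mu(x,y)u$ is a representation of $\mathfrak g$, with $D_{\rho_H,\mu_H}(x,y)u=[\![Hx,Hy,u]\!]_{\mathfrak h}+D(x,y)u$. Put $\mathfrak C^0_H(\mathfrak g,\mathfrak h)=\wedge^2\mathfrak g$ and $\mathfrak C^n_H(\mathfrak g,\mathfrak h)=C^n_{\rm LieY}(\mathfrak g,\mathfrak h)$ for $n\ge1$;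 $\delta^H$ is the coboundary $\delta$ with coefficients in $(\mathfrak h;\rho_H,\mu_H)$. The differential $\partial$ equals $\delta^H$ in degrees $\ge1$, and in degree $0$ is $\partial(x\wedge y)(z)=\mu(y,z)(Hx)-\mu(x,z)(Hy)+[\![Hx,Hy,Hz]\!]_{\mathfrak h}$. $\mathcal H^n_H(\mathfrak g,\mathfrak h)$ is the $n$-th cohomology of the complex $(\bigoplus_{n\geq0}\mathfrak C^n_H(\mathfrak g,\mathfrak h),\partial)$. *)

(* Defs.v *)
From HB Require Import structures.
From mathcomp Require Import all_boot all_algebra.
From mathcomp Require Import boolp functions.

Set Implicit Arguments.
Unset Strict Implicit.
Unset Printing Implicit Defensive.
Import GRing.Theory.
Local Open Scope ring_scope.

(* Multilinear maps on finite-dimensional spaces are curried elements of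
   'Hom, so that linearity in each argument is part of their type.  A map out
   of the exterior square is a bilinear map vanishing on the diagonal, which
   in characteristic 0 is the same as a skew-symmetric one. *)

HB.mixin Record isLieYamaguti (K : fieldType) g of Vector K g := {
  bracket : 'Hom(g, 'End(g));
  triple : 'Hom(g, 'Hom(g, 'End(g)));
  bracket_alt : forall x, bracket x x = 0;
  triple_alt : forall x z, triple x x z = 0;
  ly_cyclic : forall x y z,
    bracket (bracket x y) z + bracket (bracket y z) x + bracket (bracket z x) y
    + triple x y z + triple y z x + triple z x y = 0;
  ly_triple_cyclic : forall x y z w,
    triple (bracket x y) z w + triple (bracket y z) x w
    + triple (bracket z x) y w = 0;
  ly_deriv2 : forall x y z w,
    triple x y (bracket z w) = bracket (triple x y z) w + bracket z (triple x y w);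
  ly_deriv3 : forall x y z w t,
    triple x y (triple z w t)
    = triple (triple x y z) w t + triple z (triple x y w) t
      + triple z w (triple x y t)
}.

#[short(type="lieYamagutiType")]
HB.structure Definition LieYamaguti (K : fieldType) :=
  {g of isLieYamaguti K g & Vector K g}.

Definition is_ly_hom (K : fieldType) (g h : lieYamagutiType K)
    (psi : 'Hom(g, h)) : Prop :=
  (forall x y, psi (bracket x y) = bracket (psi x) (psi y)) /\
  (forall x y z, psi (triple x y z) = triple (psi x) (psi y) (psi z)).

Section Representation.
Variables (K : fieldType) (g : lieYamagutiType K) (V : vectType K).
Variables (rho : 'Hom(g, 'End(V))) (mu : 'Hom(g, 'Hom(g, 'End(V)))).

Definition lcomm (a b : 'End(V)) : 'End(V) := (a \o b)%VF - (b \o a)%VF.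

Definition repD (x y : g) : 'End(V) :=
  mu y x - mu x y + lcomm (rho x) (rho y) - rho (bracket x y).

Record is_representation : Prop := IsRepresentation {
  rep_bracketl : forall x y z,
    mu (bracket x y) z - (mu x z \o rho y)%VF + (mu y z \o rho x)%VF = 0;
  rep_bracketr : forall x y z,
    mu x (bracket y z) - (rho y \o mu x z)%VF + (rho z \o mu x y)%VF = 0;
  rep_rho_triple : forall x y z, rho (triple x y z) = lcomm (repD x y) (rho z);
  rep_mu_mu : forall x y z w,
    (mu z w \o mu x y)%VF - (mu y w \o mu x z)%VF - mu x (triple y z w)
    + (repD y z \o mu x w)%VF = 0;
  rep_mu_triple : forall x y z w,
    mu (triple x y z) w + mu z (triple x y w) = lcomm (repD x y) (mu z w)
}.

End Representation.

Definition in_center (K : fieldType) (h : lieYamagutiType K) (u : h) : Prop :=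
  (forall v, bracket u v = 0) /\
  ((forall v w, triple u v w = 0) \/ (forall v w, triple v u w = 0)).

Section Crossed.
Variables (K : fieldType) (g h : lieYamagutiType K).
Variables (rho : 'Hom(g, 'End(h))) (mu : 'Hom(g, 'Hom(g, 'End(h)))).

Record is_action : Prop := IsAction {
  action_rep : is_representation rho mu;
  action_rho_center : forall x u, in_center (rho x u);
  action_mu_center : forall x y u, in_center (mu x y u);
  action_rho_bracket : forall x u v, rho x (bracket u v) = 0;
  action_mu_bracket : forall x y u v, mu x y (bracket u v) = 0;
  action_rho_triple : forall x u v w, rho x (triple u v w) = 0;
  action_mu_triple : forall x y u v w, mu x y (triple u v w) = 0
}.

Definition is_crossed_hom (H : 'Hom(g, h)) : Prop :=
  (forall x y, H (bracket x y)
     = rho x (H y) - rho y (H x) + bracket (H x) (H y)) /\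
  (forall x y z, H (triple x y z)
     = repD rho mu x y (H z) + mu y z (H x) - mu x z (H y)
       + triple (H x) (H y) (H z)).

Record is_crossed_hom_morphism (H' H : 'Hom(g, h))
    (psig : 'End(g)) (psih : 'End(h)) : Prop := IsCrossedHomMorphism {
  crossed_morph_g : is_ly_hom psig;
  crossed_morph_h : is_ly_hom psih;
  crossed_morph_comm : forall x, psih (H' x) = H (psig x);
  crossed_morph_rho : forall x u, psih (rho x u) = rho (psig x) (psih u);
  crossed_morph_mu : forall x y u, psih (mu x y u) = mu (psig x) (psig y) (psih u)
}.

End Crossed.

Section LinearClosure.
Variables (K : fieldType) (U V : lmodType K).

Lemma lin_D (f1 f2 : U -> V) :
  linear f1 -> linear f2 -> linear (fun u => f1 u + f2 u).
Proof. by move=> l1 l2 a u v; rewrite l1 l2 scalerDr addrACA. Qed.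

Lemma lin_N (f1 : U -> V) : linear f1 -> linear (fun u => - f1 u).
Proof. by move=> l1 a u v; rewrite l1 opprD scalerN. Qed.

Lemma lin_B (f1 f2 : U -> V) :
  linear f1 -> linear f2 -> linear (fun u => f1 u - f2 u).
Proof. by move=> l1 l2; apply: lin_D => //; exact: lin_N. Qed.

Lemma lin_Z c (f1 : U -> V) : linear f1 -> linear (fun u => c *: f1 u).
Proof. by move=> l1 a u v; rewrite l1 scalerDr !scalerA mulrC. Qed.

Lemma lin_bigsum (I : finType) (P : pred I) (F : I -> U -> V) :
  (forall i, P i -> linear (F i)) -> linear (fun u => \sum_(i | P i) F i u).
Proof.
move=> Fl a u v; rewrite scaler_sumr -big_split /=.
by apply: eq_bigr => i /Fl->.
Qed.

End LinearClosure.

Section Alternating.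
Variables (K : fieldType) (g : vectType K).

Definition alternating2 (V : lmodType K) (b : g * g -> V) : Prop :=
  [/\ forall x, b (x, x) = 0,
      forall a x x' y, b (a *: x + x', y) = a *: b (x, y) + b (x', y) &
      forall a x y y', b (x, a *: y + y') = a *: b (x, y) + b (x, y')].

Lemma alt2_skew (V : lmodType K) (b : g * g -> V) x y :
  alternating2 b -> b (x, y) + b (y, x) = 0.
Proof.
case=> bxx bl br; have := bxx (1 *: x + y).
by rewrite bl !br !bxx !scale1r add0r addr0.
Qed.

Lemma alt2_0 (V : lmodType K) : alternating2 (fun=> 0 : V).
Proof. by split=> *; rewrite ?scaler0 ?addr0. Qed.

Lemma alt2_linD (V : lmodType K) a (b c : g * g -> V) :
  alternating2 b -> alternating2 c -> alternating2 (fun p => a *: b p + c p).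
Proof.
case=> b0 bl br [c0 cl cr]; split=> [x|t x x' y|t x y y'].
- by rewrite b0 c0 scaler0 addr0.
- by rewrite bl cl !scalerDr !scalerA [a * t]mulrC addrACA.
- by rewrite br cr !scalerDr !scalerA [a * t]mulrC addrACA.
Qed.

Lemma alt2_ext (V : lmodType K) (b c : g * g -> V) :
  b =1 c -> alternating2 b -> alternating2 c.
Proof.
by move=> /funext<-.
Qed.

Lemma alt2_D (V : lmodType K) (b c : g * g -> V) :
  alternating2 b -> alternating2 c -> alternating2 (fun p => b p + c p).
Proof.
by move=> b2 c2; apply: alt2_ext (alt2_linD 1 b2 c2) => p; rewrite scale1r.
Qed.

Lemma alt2_Z (V : lmodType K) a (b : g * g -> V) :
  alternating2 b -> alternating2 (fun p => a *: b p).
Proof.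
by move=> b2; apply: alt2_ext (alt2_linD a b2 (@alt2_0 V)) => p; rewrite addr0.
Qed.

Lemma alt2_B (V : lmodType K) (b c : g * g -> V) :
  alternating2 b -> alternating2 c -> alternating2 (fun p => b p - c p).
Proof.
move=> b2 c2; apply: alt2_ext (alt2_linD (-1) c2 b2) => p.
by rewrite scaleN1r addrC.
Qed.

Lemma alt2_sum (V : lmodType K) (I : finType) (P : pred I)
    (b : I -> g * g -> V) :
  (forall i, P i -> alternating2 (b i)) ->
  alternating2 (fun p => \sum_(i | P i) b i p).
Proof.
move=> b2; split=> [x|a x x' y|a x y y'].
- by rewrite big1 // => i /b2[].
- rewrite scaler_sumr -big_split; apply: eq_bigr => i /b2[_ bl _]; exact: bl.
- rewrite scaler_sumr -big_split; apply: eq_bigr => i /b2[_ _ br]; exact: br.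
Qed.

Lemma lin0 (V W : lmodType K) (f : V -> W) : linear f -> f 0 = 0.
Proof.
move=> fl; have := fl 1 0 0; rewrite !scale1r addr0 => /eqP.
by rewrite -subr_eq0 opprD addrA subrr sub0r oppr_eq0 => /eqP.
Qed.

Lemma alt2_lin (V W : lmodType K) (f : V -> W) (b : g * g -> V) :
  linear f -> alternating2 b -> alternating2 (fun p => f (b p)).
Proof.
move=> fl [b0 bl br]; split=> [x|a x x' y|a x y y'].
- by rewrite b0 lin0.
- by rewrite bl fl.
- by rewrite br fl.
Qed.

Lemma linB (V : lmodType K) a (u u' v v' : V) :
  a *: u + u' - (a *: v + v') = a *: (u - v) + (u' - v').
Proof. by rewrite scalerBr opprD addrACA. Qed.

Lemma alt2_anti (V : lmodType K) (c : g -> g -> V) :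
  (forall y, linear (c^~ y)) -> (forall x, linear (c x)) ->
  alternating2 (fun p => c p.1 p.2 - c p.2 p.1).
Proof.
move=> cl cr; split=> [x|a x x' y|a x y y'] /=; first by rewrite subrr.
- by rewrite (cl y) (cr y) linB.
- by rewrite (cl x) (cr x) linB.
Qed.

End Alternating.

(* The exterior square of g, in the coordinates with respect to the basis
   e_i /\ e_j, i < j, where e is the basis vbasis {:g} of g. *)
Section ExteriorSquare.
Variables (K : fieldType) (g : vectType K).

Local Notation dimg := (\dim {:g}).
Local Notation e := (vbasis {:g}).

Definition ext2 : lmodType K :=
  {ffun {ij : 'I_dimg * 'I_dimg | (ij.1 < ij.2)%N} -> K^o}.

Definition wedge (x y : g) : ext2 :=
  [ffun ij => coord e (val ij).1 x * coord e (val ij).2 y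
              - coord e (val ij).2 x * coord e (val ij).1 y].

Definition ext2_lift (V : lmodType K) (b : g -> g -> V) (w : ext2) : V :=
  \sum_ij w ij *: b e`_(val ij).1 e`_(val ij).2.

Lemma ext2_lift_is_linear (V : lmodType K) (b : g -> g -> V) :
  linear (ext2_lift b).
Proof.
move=> a w w'; rewrite scaler_sumr -big_split /=.
by apply: eq_bigr => ij _; rewrite !ffunE scalerDl scalerA.
Qed.

HB.instance Definition _ (V : lmodType K) (b : g -> g -> V) :=
  GRing.isLinear.Build K ext2 V *:%R (ext2_lift b) (ext2_lift_is_linear b).

Lemma lin_sum (V : lmodType K) (f : g -> V) n (a : 'I_n -> K) (v : 'I_n -> g) :
  linear f ->
  f (\sum_i a i *: v i) = \sum_i a i *: f (v i).
Proof.
move=> fl.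
have f0 := lin0 fl.
elim/big_rec2: _ => // i x y _ <-; exact: fl.
Qed.

Lemma ext2_lift_wedge (V : lmodType K) (b : g -> g -> V) x y :
  alternating2 (fun p => b p.1 p.2) -> ext2_lift b (wedge x y) = b x y.
Proof.
move=> b2; have [b0 bl br] := b2.
pose c i v := coord e i v.
pose F (ij : 'I_dimg * 'I_dimg) := (c ij.1 x * c ij.2 y) *: b e`_ij.1 e`_ij.2.
have bE : b x y = \sum_ij F ij.
  rewrite -(pair_bigA _ (fun i j => F (i, j))) /=.
  rewrite {1}(coord_vbasis (memvf y)) (@lin_sum _ (b x) _ _ _ (fun a => br a x)) exchange_big /=.
  apply: eq_bigr => j _; rewrite {1}(coord_vbasis (memvf x)).
  rewrite (@lin_sum _ (b^~ e`_j) _ _ _ (fun a v w => bl a v w e`_j)) scaler_sumr.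
  by apply: eq_bigr => i _; rewrite scalerA mulrC.
rewrite bE (bigID (fun ij : 'I_dimg * 'I_dimg => (ij.1 < ij.2)%N)) /=.
rewrite [X in _ + X](bigID (fun ij : 'I_dimg * 'I_dimg => (ij.1 == ij.2))) /=.
rewrite [X in _ + (X + _)]big1 ?add0r; last first.
  move=> [i j] /= /andP[_ /eqP->].
  by rewrite /F /= (b0 e`_j) scaler0.
rewrite [X in _ = _ + X](reindex_inj (can_inj (@swap_pairK _ _))) /=.
rewrite [X in _ = _ + X](eq_bigl (fun ij : 'I_dimg * 'I_dimg => (ij.1 < ij.2)%N));
  last by move=> ij /=; rewrite -leqNgt ltn_neqAle eq_sym andbC.
rewrite -big_split /= (reindex_omap (val : {ij : 'I_dimg * 'I_dimg | (ij.1 < ij.2)%N} -> _) insub)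
  /=; last first.
  by move=> ij lt_ij; rewrite insubT.
symmetry; apply: eq_big => [[ij lt_ij]|ij _] /=.
  by rewrite insubT lt_ij /= eqxx.
rewrite ffunE /F /= scalerBl /c; congr (_ + _).
have /eqP := alt2_skew e`_(val ij).1 e`_(val ij).2 b2.
by rewrite addrC addr_eq0 => /eqP /= ->; rewrite scalerN.
Qed.

End ExteriorSquare.

(* Elements of Hom((/\^2 g)^{(x)n}, V): functions of n pairs (x_i, y_i),
   standing for the x_i /\ y_i, that are bilinear and alternating in each
   pair.  Hom((/\^2 g)^{(x)n} (x) g, V) is mform g n 'Hom(g, V). *)
Section Multilinear.
Variables (K : fieldType) (g : vectType K).

Definition upd n (X : 'I_n -> g * g) (i : 'I_n) (p : g * g) : 'I_n -> g * g :=
  fun j => if j == i then p else X j.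

Definition omit n (X : 'I_n.+1 -> g * g) (k : 'I_n.+1) : 'I_n -> g * g :=
  fun i => X (lift k i).

Definition multilin n (V : lmodType K) : {pred ('I_n -> g * g) -> V} :=
  fun f => `[< forall i X, alternating2 (fun p => f (upd X i p)) >].

Lemma multilin_submod n (V : lmodType K) : submod_closed (@multilin n V).
Proof.
split=> [|a f f' /asboolP fP /asboolP f'P]; apply/asboolP => i X.
  exact: alt2_0.
exact: alt2_linD.
Qed.

HB.instance Definition _ n (V : lmodType K) :=
  GRing.isSubmodClosed.Build K (('I_n -> g * g) -> V) (@multilin n V)
    (@multilin_submod n V).

Record mform n (V : lmodType K) := MForm {
  mform_val :> ('I_n -> g * g) -> V;
  _ : mform_val \in @multilin n V
}.

HB.instance Definition _ n V := [isSub for @mform_val n V].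
HB.instance Definition _ n V := [Choice of mform n V by <:].
HB.instance Definition _ n V := [SubChoice_isSubLmodule of mform n V by <:].

Lemma mformP n V (f : mform n V) i X : alternating2 (fun p => f (upd X i p)).
Proof. by case: f => f /= /asboolP. Qed.

End Multilinear.

Section ModuleQuotient.
Local Open Scope quotient_scope.
Variables (K : fieldType) (V : lmodType K).
Variables (I : {pred V}) (subI : submod_closed I).

Definition modquot_zmod : zmodClosed V :=
  HB.pack I (GRing.isZmodClosed.Build V I (GRing.submod_closedB subI)).

Definition modquot := Quotient.quot modquot_zmod.

HB.instance Definition _ := GRing.Zmodule.on modquot.

Definition modpi (v : V) : modquot := \pi_(Quotient.quot modquot_zmod) v.

Definition modquot_scale (a : K) (x : modquot) : modquot :=
  modpi (a *: repr (x : (Quotient.quot modquot_zmod))).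

Lemma modpi_eq v w : modpi v = modpi w <-> v - w \in I.
Proof.
have := Quotient.idealrBE modquot_zmod v w.
rewrite -[v - w \in modquot_zmod]/(v - w \in I) => ->.
by split=> [|/eqP//] /eqP.
Qed.

Lemma modpiD v w : modpi (v + w) = modpi v + modpi w.
Proof. exact: (raddfD \pi_(Quotient.quot modquot_zmod)). Qed.

Lemma modpi_surj x : exists v, x = modpi v.
Proof. by exists (repr (x : (Quotient.quot modquot_zmod))); rewrite /modpi reprK. Qed.

Lemma submodI_Z a v : v \in I -> a *: v \in I.
Proof. by case: subI => I0 IP Iv; rewrite -[_ *: _]addr0; exact: IP. Qed.

Lemma modpiZ a v : modpi (a *: v) = modquot_scale a (modpi v).
Proof.
apply/modpi_eq; rewrite -scalerBr submodI_Z //; apply/modpi_eq.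
by rewrite /modpi reprK.
Qed.

Lemma modquot_scaleA a b x :
  modquot_scale a (modquot_scale b x) = modquot_scale (a * b) x.
Proof. by have [v ->] := modpi_surj x; rewrite -!modpiZ scalerA. Qed.

Lemma modquot_scale1 x : modquot_scale 1 x = x.
Proof. by have [v ->] := modpi_surj x; rewrite -!modpiZ scale1r. Qed.

Lemma modquot_scaleDr : right_distributive modquot_scale +%R.
Proof.
move=> a x y; have [v ->] := modpi_surj x; have [w ->] := modpi_surj y.
by rewrite -modpiD -!modpiZ scalerDr modpiD.
Qed.

Lemma modquot_scaleDl x : {morph modquot_scale^~ x : a b / a + b}.
Proof.
by move=> a b; have [v ->] := modpi_surj x; rewrite -!modpiZ -modpiD scalerDl.
Qed.

HB.instance Definition _ := GRing.Zmodule_isLmodule.Build K modquot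
  modquot_scaleA modquot_scale1 modquot_scaleDr modquot_scaleDl.

Lemma modpi_is_linear : linear modpi.
Proof. by move=> a v w; rewrite modpiD modpiZ. Qed.

HB.instance Definition _ :=
  GRing.isLinear.Build K V modquot *:%R modpi modpi_is_linear.

End ModuleQuotient.

(* The homology ker d2 / im d1 at B of a complex A -> B -> C, written as the
   quotient of ker d2 by the elements of ker d2 that lie in im d1, so that it
   is defined without a proof of d2 (d1 a) = 0. *)
Section Homology.
Variables (K : fieldType) (A B C : lmodType K).
Variables (d1 : {linear A -> B}) (d2 : {linear B -> C}).

Definition cocycle_pred : {pred B} := fun b => d2 b == 0.

Lemma cocycle_pred_submod : submod_closed cocycle_pred.
Proof.
split=> [|a b c /eqP b0 /eqP c0]; first by apply/eqP; rewrite raddf0.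
by apply/eqP; rewrite linearP b0 c0 scaler0 addr0.
Qed.

HB.instance Definition _ :=
  GRing.isSubmodClosed.Build K B cocycle_pred cocycle_pred_submod.

Record cocycle := Cocycle {
  cocycle_val : B;
  _ : cocycle_val \in cocycle_pred
}.

HB.instance Definition _ := [isSub for cocycle_val].
HB.instance Definition _ := [Choice of cocycle by <:].
HB.instance Definition _ := [SubChoice_isSubLmodule of cocycle by <:].

Definition coboundary_pred : {pred cocycle} :=
  fun z => `[< exists a : A, d1 a = val z >].

Lemma coboundary_pred_submod : submod_closed coboundary_pred.
Proof.
split=> [|a x y /asboolP[u ux] /asboolP[v vy]]; apply/asboolP.
  by exists 0; rewrite raddf0.
by exists (a *: u + v); rewrite linearP ux vy.
Qed.

Definition homology : lmodType K := modquot coboundary_pred_submod.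

Definition homology_class : {linear cocycle -> homology} :=
  modpi coboundary_pred_submod.

End Homology.

Section Slots.
Variables (K : fieldType) (g : vectType K).
Implicit Types (p q : g * g).

Lemma upd_same n (X : 'I_n -> g * g) i p : upd X i p i = p.
Proof. by rewrite /upd eqxx. Qed.

Lemma upd_other n (X : 'I_n -> g * g) i j p : j != i -> upd X i p j = X j.
Proof. by rewrite /upd => /negbTE->. Qed.

Lemma updC n (X : 'I_n -> g * g) i j p q :
  i != j -> upd (upd X i p) j q = upd (upd X j q) i p.
Proof.
move=> ij; apply/funext => k; rewrite /upd.
by case: (k =P j) => [->|//]; rewrite eq_sym (negbTE ij).
Qed.

Lemma upd_upd n (X : 'I_n -> g * g) i p q : upd (upd X i p) i q = upd X i q.
Proof. by apply/funext => k; rewrite /upd; case: (k == i). Qed.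

Lemma omit_upd_same n (X : 'I_n.+1 -> g * g) k p :
  omit (upd X k p) k = omit X k.
Proof.
by apply/funext => i; rewrite /omit /upd eq_sym (negbTE (neq_lift _ _)).
Qed.

Lemma omit_upd_lift n (X : 'I_n.+1 -> g * g) k j p :
  omit (upd X (lift k j) p) k = upd (omit X k) j p.
Proof.
by apply/funext => i; rewrite /omit /upd (inj_eq (@lift_inj _ k)).
Qed.

Lemma mform_upd n (V : lmodType K) (f : mform g n V) X i a x x' y :
  f (upd X i (a *: x + x', y)) = a *: f (upd X i (x, y)) + f (upd X i (x', y)).
Proof. by have [_ fl _] := mformP f i X. Qed.

End Slots.

Section Coboundary.
Variables (K : fieldType) (g : lieYamagutiType K) (V : vectType K).
Variables (rho : 'Hom(g, 'End(V))) (mu : 'Hom(g, 'Hom(g, 'End(V)))).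

(* The value of f at X with X_k omitted and X_l replaced by
   X_k o X_l = [[x_k, y_k, x_l]] /\ y_l + x_l /\ [[x_k, y_k, y_l]]. *)
Definition circ n (W : lmodType K) (f : mform g n W) (X : 'I_n.+1 -> g * g)
    (k l : 'I_n.+1) : W :=
  f (omit (upd X l (triple (X k).1 (X k).2 (X l).1, (X l).2)) k)
  + f (omit (upd X l ((X l).1, triple (X k).1 (X k).2 (X l).2)) k).

(* Indices start from 0, hence the shift of the signs (-1)^k; the last pair
   X_{n+1} is X ord_max. *)
Definition cobI_fun n (f : mform g n V) (G : mform g n 'Hom(g, V))
    (X : 'I_n.+1 -> g * g) : V :=
  let x i := (X i).1 in let y i := (X i).2 in let m := ord_max in
  (-1) ^+ n *: (rho (x m) (G (omit X m) (y m)) - rho (y m) (G (omit X m) (x m))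
                - G (omit X m) (bracket (x m) (y m)))
  + \sum_(k < n.+1 | (k < n)%N) (-1) ^+ k *: repD rho mu (x k) (y k) (f (omit X k))
  + \sum_(k < n.+1) \sum_(l < n.+1 | (k < l)%N) (-1) ^+ k.+1 *: circ f X k l.

Definition cobII_fun n (G : mform g n 'Hom(g, V))
    (X : 'I_n.+1 -> g * g) (z : g) : V :=
  let x i := (X i).1 in let y i := (X i).2 in let m := ord_max in
  (-1) ^+ n *: (mu (y m) z (G (omit X m) (x m)) - mu (x m) z (G (omit X m) (y m)))
  + \sum_(k < n.+1) (-1) ^+ k *: repD rho mu (x k) (y k) (G (omit X k) z)
  + \sum_(k < n.+1) \sum_(l < n.+1 | (k < l)%N) (-1) ^+ k.+1 *: circ G X k l z
  + \sum_(k < n.+1) (-1) ^+ k.+1 *: G (omit X k) (triple (x k) (y k) z).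

Definition cob1I_fun (f : 'Hom(g, V)) (X : 'I_1 -> g * g) : V :=
  let x := (X ord0).1 in let y := (X ord0).2 in
  rho x (f y) - rho y (f x) - f (bracket x y).

Definition cob1II_fun (f : 'Hom(g, V)) (X : 'I_1 -> g * g) (z : g) : V :=
  let x := (X ord0).1 in let y := (X ord0).2 in
  repD rho mu x y (f z) + mu y z (f x) - mu x z (f y) - f (triple x y z).

Let lfE := (add_lfunE, opp_lfunE, scale_lfunE, comp_lfunE, zero_lfunE).

Lemma alt2_Hom (W : vectType K) (b : g * g -> 'Hom(g, W)) :
  (forall z, alternating2 (fun p => b p z)) -> alternating2 b.
Proof.
move=> b2; split=> [x|a x x' y|a x y y']; apply/lfunP => z;
  have [b0 bl br] := b2 z; rewrite !lfE; [exact: b0|exact: bl|exact: br].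
Qed.

Lemma alt2_bracket : alternating2 (fun p : g * g => bracket p.1 p.2).
Proof.
split=> [x|a x x' y|a x y y'] /=; first exact: bracket_alt.
- by rewrite linearP !lfE.
- by rewrite linearP.
Qed.

Lemma alt2_triple z : alternating2 (fun p : g * g => triple p.1 p.2 z).
Proof.
split=> [x|a x x' y|a x y y'] /=; first exact: triple_alt.
- by rewrite linearP !lfE.
- by rewrite linearP !lfE.
Qed.

Lemma alt2_repD v : alternating2 (fun p : g * g => repD rho mu p.1 p.2 v).
Proof.
pose c1 (x y : g) := mu y x v; pose c2 x y := rho x (rho y v).
apply: (@alt2_ext _ _ _ (fun p => (c1 p.1 p.2 - c1 p.2 p.1)
  + (c2 p.1 p.2 - c2 p.2 p.1) - rho (bracket p.1 p.2) v)).
  by move=> p; rewrite /repD /lcomm !lfE.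
apply: alt2_B; first apply: alt2_D.
- by apply: alt2_anti => [y a x x'|x a y y']; rewrite /c1 linearP !lfE.
- apply: alt2_anti => [y a x x'|x a y y']; rewrite /c2 linearP !lfE //.
  by rewrite linearP.
- apply: (@alt2_lin _ _ _ _ (fun x : g => rho x v)); last exact: alt2_bracket.
  by move=> a x x'; rewrite linearP !lfE.
Qed.

Lemma alt2_circ n (W : lmodType K) (f : mform g n W) X (k l : 'I_n.+1) i :
  (k < l)%N -> alternating2 (fun p => circ f (upd X i p) k l).
Proof.
move=> ltkl; have nlk : l != k by rewrite neq_ltn ltkl orbT.
have [j ljk|lk] := unliftP k l; last by rewrite lk eqxx in nlk.
apply: (@alt2_ext _ _ _ (fun p => let Y := upd X i p in
  f (upd (omit Y k) j (triple (Y k).1 (Y k).2 (Y l).1, (Y l).2))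
  + f (upd (omit Y k) j ((Y l).1, triple (Y k).1 (Y k).2 (Y l).2)))).
  by move=> p /=; rewrite /circ ljk !omit_upd_lift.
have [f0 fl fr] := mformP f j (omit X k).
have [i' ii'|->] := unliftP k i; last first.
  apply: (@alt2_ext _ _ _ (fun p =>
    f (upd (omit X k) j (triple p.1 p.2 (X l).1, (X l).2))
    + f (upd (omit X k) j ((X l).1, triple p.1 p.2 (X l).2)))).
    by move=> p /=; rewrite omit_upd_same upd_same upd_other.
  apply: alt2_D.
  - apply: (@alt2_lin _ _ _ _ (fun v => f (upd (omit X k) j (v, (X l).2))));
      last exact: alt2_triple.
    by move=> a v w; rewrite fl.
  - apply: (@alt2_lin _ _ _ _ (fun v => f (upd (omit X k) j ((X l).1, v))));
      last exact: alt2_triple.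
    by move=> a v w; rewrite fr.
have nki : k != i by rewrite ii' neq_lift.
have [ij|nij] := eqVneq i' j.
  have il : i = l by rewrite ii' ljk ij.
  apply: (@alt2_ext _ _ _ (fun p =>
    f (upd (omit X k) j (triple (X k).1 (X k).2 p.1, p.2))
    + f (upd (omit X k) j (p.1, triple (X k).1 (X k).2 p.2)))).
    by move=> p /=; rewrite (upd_other _ _ nki) il upd_same ljk omit_upd_lift
      !upd_upd.
  split=> [x|a x x' y|a x y y'] /=; first exact: (alt2_skew _ _ (mformP f j _)).
  - by rewrite linearP !fl scalerDr addrACA.
  - by rewrite linearP !fr scalerDr addrACA.
have nli : l != i by rewrite ii' ljk (inj_eq (@lift_inj _ k)) eq_sym.
set q1 := (triple (X k).1 (X k).2 (X l).1, (X l).2).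
set q2 := ((X l).1, triple (X k).1 (X k).2 (X l).2).
apply: (@alt2_ext _ _ _ (fun p => f (upd (upd (omit X k) j q1) i' p)
  + f (upd (upd (omit X k) j q2) i' p))).
  by move=> p /=; rewrite !upd_other // ii' omit_upd_lift !(updC _ _ _ nij).
by apply: alt2_D; exact: mformP.
Qed.

Lemma linear_repD x y : linear (repD rho mu x y).
Proof. by move=> a u v; rewrite linearP. Qed.

Lemma alt2_omit n (W : lmodType K) (f : mform g n W)
    (L : g * g -> W -> V) X (k : 'I_n.+1) i :
  (forall p, linear (L p)) -> (forall w, alternating2 (L^~ w)) ->
  alternating2 (fun p => L (upd X i p k) (f (omit (upd X i p) k))).
Proof.
move=> Ll La; have [j ij|->] := unliftP k i.
  have nki : k != i by rewrite ij neq_lift.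
  apply: (@alt2_ext _ _ _ (fun p => L (X k) (f (upd (omit X k) j p)))).
    by move=> p; rewrite upd_other // ij omit_upd_lift.
  by apply: alt2_lin => //; exact: mformP.
apply: (@alt2_ext _ _ _ (fun p => L p (f (omit X k)))) => //.
by move=> p; rewrite upd_same omit_upd_same.
Qed.

Lemma cobI_multilin n (f : mform g n V) G : cobI_fun f G \in @multilin _ g n.+1 V.
Proof.
apply/asboolP => i X; apply: alt2_D; first apply: alt2_D.
- apply: alt2_Z.
  apply: (@alt2_omit _ _ G (fun p (G : 'Hom(g, V)) =>
    rho p.1 (G p.2) - rho p.2 (G p.1) - G (bracket p.1 p.2))).
  + by move=> p a G1 G2; rewrite !add_lfunE !scale_lfunE !(linearP (rho _)) !linB.
  + move=> G1; apply: alt2_B.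
      apply: (alt2_anti (c := fun x y => rho x (G1 y))) => [y a x x'|x a y y'].
        by rewrite (linearP rho) !lfE.
      by rewrite (linearP G1) (linearP (rho x)).
    apply: (@alt2_lin _ _ g V G1 (fun p => bracket p.1 p.2)); last first.
      exact: alt2_bracket.
    by move=> a u v; rewrite linearP.
- apply: alt2_sum => k _; apply: alt2_Z.
  apply: (@alt2_omit _ _ f (fun p v => repD rho mu p.1 p.2 v)).
  + by move=> p; exact: linear_repD.
  + exact: alt2_repD.
- apply: alt2_sum => k _; apply: alt2_sum => l kl; apply: alt2_Z.
  exact: alt2_circ.
Qed.

Lemma lin_circ n (W : lmodType K) X k l :
  linear (fun f : mform g n W => circ f X k l).
Proof. by apply: lin_D => a u v. Qed.

Lemma lin_Hom (W : vectType K) (z : g) : linear (fun G : 'Hom(g, W) => G z).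
Proof. by move=> a u v; rewrite !lfE. Qed.

Lemma lin_lfun (U W : vectType K) (L : 'Hom(U, W)) : linear L.
Proof. by move=> a u v; rewrite linearP. Qed.

Lemma lin_comp (U W Z : lmodType K) (f1 : W -> Z) (f2 : U -> W) :
  linear f1 -> linear f2 -> linear (fun u => f1 (f2 u)).
Proof. by move=> l1 l2 a u v; rewrite l2 l1. Qed.

Lemma lin_mu y v : linear (fun z => mu y z v).
Proof. by move=> a z z'; rewrite linearP !lfE. Qed.

Lemma lin_mu1 z v : linear (fun y => mu y z v).
Proof. by move=> a y y'; rewrite linearP !lfE. Qed.

Lemma lin_rho v : linear (fun x => rho x v).
Proof. by move=> a x x'; rewrite linearP !lfE. Qed.

Lemma lin_triple (x y : g) : linear (triple x y).
Proof. exact: lin_lfun. Qed.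

Lemma cobII_linear n G X : linear (@cobII_fun n G X).
Proof.
apply: lin_D; first apply: lin_D; first apply: lin_D.
- by apply: lin_Z; apply: lin_B; exact: lin_mu.
- apply: lin_bigsum => k _; apply: lin_Z.
  by apply: (lin_comp (@linear_repD _ _)); exact: lin_lfun.
- apply: lin_bigsum => k _; apply: lin_bigsum => l _; apply: lin_Z.
  exact: lin_lfun.
- apply: lin_bigsum => k _; apply: lin_Z.
  by apply: lin_comp; [exact: lin_lfun|exact: lin_triple].
Qed.

HB.instance Definition _ n G X :=
  GRing.isLinear.Build K g V *:%R (@cobII_fun n G X) (cobII_linear G X).

Lemma cob1II_linear f X : linear (cob1II_fun f X).
Proof.
apply: lin_B; first apply: lin_B; first apply: lin_D.
- by apply: (lin_comp (@linear_repD _ _)); exact: lin_lfun.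
- exact: lin_mu.
- exact: lin_mu.
- by apply: lin_comp; [exact: lin_lfun|exact: lin_triple].
Qed.

HB.instance Definition _ f X :=
  GRing.isLinear.Build K g V *:%R (cob1II_fun f X) (cob1II_linear f X).

Lemma cobII_multilin n (G : mform g n 'Hom(g, V)) :
  (fun X => linfun (cobII_fun G X)) \in @multilin _ g n.+1 'Hom(g, V).
Proof.
apply/asboolP => i X; apply: alt2_Hom => z.
apply: (alt2_ext (b := fun p => cobII_fun G (upd X i p) z)).
  by move=> p; rewrite lfunE.
apply: alt2_D; first apply: alt2_D; first apply: alt2_D.
- apply: alt2_Z.
  apply: (@alt2_omit _ _ G (fun p (G : 'Hom(g, V)) =>
    mu p.2 z (G p.1) - mu p.1 z (G p.2))).
  + by move=> p; apply: lin_B; apply: lin_comp; [exact: lin_lfun|exact: lin_Hom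
      |exact: lin_lfun|exact: lin_Hom].
  + move=> G1; apply: (alt2_anti (c := fun x y => mu y z (G1 x))).
      by move=> y; apply: lin_comp; exact: lin_lfun.
    by move=> x; exact: lin_mu1.
- apply: alt2_sum => k _; apply: alt2_Z.
  apply: (@alt2_omit _ _ G (fun p (G : 'Hom(g, V)) => repD rho mu p.1 p.2 (G z))).
  + by move=> p; apply: lin_comp; [exact: linear_repD|exact: lin_Hom].
  + by move=> G1; exact: alt2_repD.
- apply: alt2_sum => k _; apply: alt2_sum => l kl; apply: alt2_Z.
  by apply: (alt2_lin (lin_Hom z)); exact: alt2_circ.
- apply: alt2_sum => k _; apply: alt2_Z.
  apply: (@alt2_omit _ _ G (fun p (G : 'Hom(g, V)) => G (triple p.1 p.2 z))).
  + by move=> p; exact: lin_Hom.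
  + move=> G1; apply: (alt2_lin (lin_lfun G1)); exact: alt2_triple.
Qed.

Definition cobI n f G : mform g n.+1 V := MForm (@cobI_multilin n f G).

Definition cobII n G : mform g n.+1 'Hom(g, V) := MForm (@cobII_multilin n G).

Lemma cob1I_multilin f : cob1I_fun f \in @multilin _ g 1 V.
Proof.
apply/asboolP => i X; rewrite (ord1 i).
apply: (alt2_ext (b := fun p => rho p.1 (f p.2) - rho p.2 (f p.1)
                               - f (bracket p.1 p.2))).
  by move=> p; rewrite /cob1I_fun upd_same.
apply: alt2_B; last by apply: (alt2_lin (lin_lfun f)); exact: alt2_bracket.
apply: (alt2_anti (c := fun x y => rho x (f y))).
  by move=> y; exact: lin_rho.
by move=> x; apply: lin_comp; exact: lin_lfun.
Qed.

Lemma cob1II_multilin f :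
  (fun X => linfun (cob1II_fun f X)) \in @multilin _ g 1 'Hom(g, V).
Proof.
apply/asboolP => i X; rewrite (ord1 i); apply: alt2_Hom => z.
apply: (alt2_ext (b := fun p => repD rho mu p.1 p.2 (f z)
   + (mu p.2 z (f p.1) - mu p.1 z (f p.2)) - f (triple p.1 p.2 z))).
  by move=> p; rewrite [RHS]lfunE /= /cob1II_fun upd_same !addrA.
apply: alt2_B; last by apply: (alt2_lin (lin_lfun f)); exact: alt2_triple.
apply: alt2_D; first exact: alt2_repD.
apply: (alt2_anti (c := fun x y => mu y z (f x))).
  by move=> y; apply: lin_comp; exact: lin_lfun.
by move=> x; exact: lin_mu1.
Qed.

Definition cob1I f : mform g 1 V := MForm (cob1I_multilin f).

Definition cob1II f : mform g 1 'Hom(g, V) := MForm (cob1II_multilin f).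

Lemma lin_repD x y : linear (repD rho mu x y).
Proof. exact: lin_lfun. Qed.

Lemma lin_mform n (W : lmodType K) X : linear (fun f : mform g n W => f X).
Proof. by []. Qed.

Lemma cob1I_linear : linear cob1I.
Proof.
move=> a f f'; apply/val_inj/funext => X; move: a f f'.
apply: lin_B; last exact: lin_Hom.
by apply: lin_B; apply: lin_comp; [exact: lin_lfun|exact: lin_Hom
  |exact: lin_lfun|exact: lin_Hom].
Qed.

Lemma cob1II_linear_cochain : linear cob1II.
Proof.
move=> a f f'; apply/val_inj/funext => X /=; apply/lfunP => z.
rewrite lfunE [RHS]lin_Hom !lfunE /=; move: a f f'.
apply: lin_B; last exact: lin_Hom.
apply: lin_B; last by apply: lin_comp; [exact: lin_lfun|exact: lin_Hom].
by apply: lin_D; apply: lin_comp; [exact: lin_lfun|exact: lin_Hom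
  |exact: lin_lfun|exact: lin_Hom].
Qed.

Lemma cobI_linear n :
  linear (fun fG : mform g n V * mform g n 'Hom(g, V) => cobI fG.1 fG.2).
Proof.
move=> a f f'; apply/val_inj/funext => X; move: a f f'.
have lG (Y : 'I_n -> g * g) z :
    linear (fun fG : mform g n V * mform g n 'Hom(g, V) => fG.2 Y z).
  by move=> a u v; exact: (lin_Hom z a (u.2 Y) (v.2 Y)).
apply: lin_D; first apply: lin_D.
- apply: lin_Z; apply: lin_B => //.
  by apply: lin_B; apply: lin_comp => //; exact: lin_lfun.
- apply: lin_bigsum => k _; apply: lin_Z.
  by apply: (lin_comp (@lin_repD _ _)).
- apply: lin_bigsum => k _; apply: lin_bigsum => l _; apply: lin_Z.
  by apply: (lin_comp (@lin_circ _ _ X k l)).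
Qed.

Lemma cobII_linear_cochain n : linear (@cobII n).
Proof.
move=> a G G'; apply/val_inj/funext => X /=; apply/lfunP => z.
rewrite lfunE [RHS]lin_Hom !lfunE /=; move: a G G'.
have lG (Y : 'I_n -> g * g) x :
    linear (fun G : mform g n 'Hom(g, V) => G Y x).
  by move=> a u v; exact: (lin_Hom x a (u Y) (v Y)).
apply: lin_D; first apply: lin_D; first apply: lin_D.
- by apply: lin_Z; apply: lin_B; apply: lin_comp => //; exact: lin_lfun.
- apply: lin_bigsum => k _; apply: lin_Z.
  by apply: (lin_comp (@lin_repD _ _)).
- apply: lin_bigsum => k _; apply: lin_bigsum => l _; apply: lin_Z.
  exact: (lin_comp (lin_Hom z) (@lin_circ _ _ X k l)).
- by apply: lin_bigsum => k _; apply: lin_Z.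
Qed.

End Coboundary.

Section Cochains.
Variables (K : fieldType) (g : lieYamagutiType K) (V : vectType K).

Definition cochain (n : nat) : lmodType K :=
  match n with
  | 0 => ext2 g
  | 1 => 'Hom(g, V)
  | m.+2 => (mform g m.+1 V * mform g m.+1 'Hom(g, V))%type
  end.

Variables (rho : 'Hom(g, 'End(V))) (mu : 'Hom(g, 'Hom(g, 'End(V)))).

(* The coboundary from degree n.+1 to degree n.+2. *)
Definition coboundary (n : nat) : cochain n.+1 -> cochain n.+2 :=
  match n return cochain n.+1 -> cochain n.+2 with
  | 0 => fun f => (cob1I rho f, cob1II rho mu f)
  | m.+1 => fun fG => (cobI rho mu fG.1 fG.2, cobII rho mu fG.2)
  end.

Lemma coboundary_linear n : linear (@coboundary n).
Proof.
case: n => [|m] a f f'.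
  by congr pair; [exact: cob1I_linear|exact: cob1II_linear_cochain].
by congr pair; [exact: cobI_linear|exact: cobII_linear_cochain].
Qed.

HB.instance Definition _ n :=
  GRing.isLinear.Build K (cochain n.+1) (cochain n.+2) *:%R (@coboundary n)
    (@coboundary_linear n).

End Cochains.

Section CrossedCohomology.
Variables (K : fieldType) (g h : lieYamagutiType K).
Variables (rho : 'Hom(g, 'End(h))) (mu : 'Hom(g, 'Hom(g, 'End(h)))).
Variable H : 'Hom(g, h).

Definition rhoH_fun (x : g) (u : h) : h := bracket (H x) u + rho x u.

Definition muH_fun (x y : g) (u : h) : h := triple u (H x) (H y) + mu x y u.

Definition partial0_fun (x y z : g) : h :=
  mu y z (H x) - mu x z (H y) + triple (H x) (H y) (H z).

(* The (multi)linear maps given by the functions above: see rhoHE, muHE and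
   partial0E. *)
Definition rhoH : 'Hom(g, 'End(h)) := linfun (fun x => linfun (rhoH_fun x)).

Definition muH : 'Hom(g, 'Hom(g, 'End(h))) :=
  linfun (fun x => linfun (fun y => linfun (muH_fun x y))).

Definition partial0 (x y : g) : 'Hom(g, h) := linfun (partial0_fun x y).

Lemma linfunE (U W : vectType K) (f : U -> W) : linear f -> linfun f =1 f.
Proof.
move=> fl u; pose f1 := GRing.isLinear.Build K U W *:%R f fl.
pose F : {linear U -> W} := HB.pack f f1.
exact: (lfunE F u).
Qed.

Let lfE := (add_lfunE, opp_lfunE, scale_lfunE, comp_lfunE, zero_lfunE).

Lemma rhoHE x u : rhoH x u = bracket (H x) u + rho x u.
Proof.
have l2 y : linear (rhoH_fun y) by apply: lin_D; exact: lin_lfun.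
rewrite /rhoH linfunE ?linfunE //.
move=> a y y'; apply/lfunP => v; rewrite !lfE ?linfunE //.
by rewrite /rhoH_fun !linearP !lfE scalerDr addrACA.
Qed.

Lemma muHE x y u : muH x y u = triple u (H x) (H y) + mu x y u.
Proof.
have l3 a b : linear (muH_fun a b).
  apply: lin_D; last exact: lin_lfun.
  by move=> t v v'; rewrite linearP !lfE.
have l2 b : linear (fun c => linfun (muH_fun b c)).
  move=> a c c'; apply/lfunP => v; rewrite !lfE ?linfunE //.
  by rewrite /muH_fun !linearP !lfE scalerDr addrACA.
rewrite /muH linfunE ?linfunE //.
move=> a b b'; apply/lfunP => c; rewrite !lfE ?linfunE //.
apply/lfunP => v; rewrite !lfE ?linfunE //.
by rewrite /muH_fun !linearP !lfE scalerDr addrACA.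
Qed.

Lemma partial0E x y z : partial0 x y z
  = mu y z (H x) - mu x z (H y) + triple (H x) (H y) (H z).
Proof.
rewrite linfunE //; apply: lin_D; first by apply: lin_B; exact: lin_mu.
by move=> a v v'; rewrite !linearP.
Qed.

Lemma alt2_partial0 : alternating2 (fun p => partial0 p.1 p.2).
Proof.
apply: alt2_Hom => z.
apply: (alt2_ext (b := fun p => (mu p.2 z (H p.1) - mu p.1 z (H p.2))
   + triple (H p.1) (H p.2) (H z))); first by move=> p; rewrite partial0E.
apply: alt2_D; first apply: (alt2_anti (c := fun x y => mu y z (H x))).
- by move=> y a x x'; rewrite !linearP.
- by move=> x; exact: lin_mu1.
split=> [x|a x x' y|a x y y'] /=; first exact: triple_alt.
- by rewrite !linearP !lfE.
- by rewrite !linearP !lfE.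
Qed.

(* The differential of the complex of H, from degree n to degree n.+1. *)
Definition differential (n : nat) : {linear cochain g h n -> cochain g h n.+1} :=
  match n return {linear cochain g h n -> cochain g h n.+1} with
  | 0 => ext2_lift partial0
  | m.+1 => @coboundary K g h rhoH muH m
  end.

Lemma differential0_wedge x y : differential 0 (wedge x y) = partial0 x y.
Proof. exact: (ext2_lift_wedge _ _ alt2_partial0). Qed.

Definition cohomology (n : nat) : lmodType K :=
  match n with
  | 0 => cocycle (differential 0)
  | m.+1 => homology (differential m) (differential m.+1)
  end.

End CrossedCohomology.

Section CochainMap.
Variables (K : fieldType) (g h : lieYamagutiType K).
Variables (psig : 'End(g)) (psih : 'End(h)).

(* (psig^-1)%VF is the inverse of psig when psig is bijective, the case of
   interest. *)
Definition pull n (X : 'I_n -> g * g) : 'I_n -> g * g :=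
  fun i => ((psig^-1)%VF (X i).1, (psig^-1)%VF (X i).2).

Definition pI_fun n (f : mform g n h) (X : 'I_n -> g * g) : h :=
  psih (f (pull X)).

Definition pII_fun n (G : mform g n 'Hom(g, h)) (X : 'I_n -> g * g) : 'Hom(g, h) :=
  (psih \o G (pull X) \o psig^-1)%VF.

Lemma pull_upd n (X : 'I_n -> g * g) i p :
  pull (upd X i p) = upd (pull X) i ((psig^-1)%VF p.1, (psig^-1)%VF p.2).
Proof. by apply/funext => j; rewrite /pull /upd; case: (j == i). Qed.

Lemma alt2_pull n (W : lmodType K) (f : mform g n W) X i :
  alternating2 (fun p => f (pull (upd X i p))).
Proof.
have [f0 fl fr] := mformP f i (pull X).
split=> [x|a x x' y|a x y y']; rewrite !pull_upd /= ?f0 //.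
- by rewrite linearP fl.
- by rewrite linearP fr.
Qed.

Lemma pI_multilin n (f : mform g n h) : pI_fun f \in @multilin _ g n h.
Proof.
by apply/asboolP => i X; apply: (alt2_lin (lin_lfun psih)); exact: alt2_pull.
Qed.

Lemma pII_multilin n (G : mform g n 'Hom(g, h)) :
  pII_fun G \in @multilin _ g n 'Hom(g, h).
Proof.
apply/asboolP => i X.
apply: (alt2_lin (f := fun L : 'Hom(g, h) => (psih \o L \o psig^-1)%VF));
  last exact: alt2_pull.
by move=> a u v; rewrite comp_lfunDr -comp_lfunZr comp_lfunDl -comp_lfunZl.
Qed.

Definition pI n f : mform g n h := MForm (@pI_multilin n f).

Definition pII n G : mform g n 'Hom(g, h) := MForm (@pII_multilin n G).

Definition pcochain (n : nat) : cochain g h n.+1 -> cochain g h n.+1 :=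
  match n return cochain g h n.+1 -> cochain g h n.+1 with
  | 0 => fun f => (psih \o f \o psig^-1)%VF
  | m.+1 => fun fG => (pI fG.1, pII fG.2)
  end.

Lemma pcochain_linear n : linear (@pcochain n).
Proof.
have lc a (u v : 'Hom(g, h)) : (psih \o (a *: u + v) \o psig^-1
    = a *: (psih \o u \o psig^-1) + (psih \o v \o psig^-1))%VF.
  by rewrite comp_lfunDr -comp_lfunZr comp_lfunDl -comp_lfunZl.
case: n => [|m] a u v; first exact: lc.
by congr pair; apply/val_inj/funext => X; [exact: linearP|exact: lc].
Qed.

HB.instance Definition _ n :=
  GRing.isLinear.Build K (cochain g h n.+1) (cochain g h n.+1) *:%R
    (@pcochain n) (@pcochain_linear n).

End CochainMap.

(* Main.v *)
Require Import Defs.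
From HB Require Import structures.
From mathcomp Require Import all_boot all_algebra.
From mathcomp Require Import boolp.

Set Implicit Arguments.
Unset Strict Implicit.
Unset Printing Implicit Defensive.
Import GRing.Theory.
Local Open Scope ring_scope.

(** The Yamaguti coboundary is built naturally from the two brackets of g, the
    pair (rho, mu) and composition, so it commutes with transport of structure.
    Transport is available here because (psig, psih) intertwines not only the
    action (rho, mu) with itself but also the representation (rho_H', mu_H')
    with (rho_H, mu_H): the extra terms [H' x, u] and [[u, H' x, H' y]] are
    carried to [H (psig x), psih u] and [[psih u, H (psig x), H (psig y)]],
    since psih preserves the brackets of h and psih \o H' = H \o psig
    ([intertwines_crossed]).  Each summand of the coboundary formula is then
    carried to the summand with the same index ([pcochain_coboundary]).

    On cohomology, a cochain map descends to the quotients as soon as it sends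
    coboundaries to coboundaries ([homology_functorial]).  In degrees at least
    2 this is the commutation with the differential.  In degree 1 the
    coboundaries come from the exterior square of g, to which the map p does
    not extend by its own formula; there x /\ y is moved by psig itself, and
    p (d (x /\ y)) = d (psig x /\ psig y) ([pcochain_partial0]). *)

(** * Maps induced on homology *)

Section HomologyMap.
Variables (K : fieldType) (A B C A' B' C' : lmodType K).
Variables (d1 : {linear A -> B}) (d2 : {linear B -> C}).
Variables (d1' : {linear A' -> B'}) (d2' : {linear B' -> C'}).
Variables (f : {linear B -> B'}) (fC : {linear C -> C'}).
Hypothesis f_d1 : forall a, exists a', d1' a' = f (d1 a).
Hypothesis f_d2 : forall b, d2' (f b) = fC (d2 b).

Lemma map_cocycle_subproof (z : cocycle d2) : f (val z) \in cocycle_pred d2'.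
Proof.
case: z => b /= /eqP b0.
by apply/eqP; rewrite f_d2 b0 raddf0.
Qed.

Definition map_cocycle (z : cocycle d2) : cocycle d2' :=
  Cocycle (map_cocycle_subproof z).

Lemma map_cocycle_is_linear : linear map_cocycle.
Proof. by move=> a u v; apply: val_inj; rewrite /= linearP. Qed.

HB.instance Definition _ :=
  GRing.isLinear.Build K (cocycle d2) (cocycle d2') *:%R map_cocycle
    map_cocycle_is_linear.

Lemma map_cocycle_coboundary (z : cocycle d2) :
  z \in coboundary_pred (d2 := d2) d1 ->
  map_cocycle z \in coboundary_pred (d2 := d2') d1'.
Proof.
move=> /asboolP[a da]; apply/asboolP; rewrite /= -da; exact: f_d1.
Qed.

(** Two cocycles with the same class differ by a coboundary, which f sends to a
    coboundary, so applying f to a chosen representative of each class is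
    independent of the choice, hence linear. *)
Lemma homology_functorial :
  exists fstar : {linear homology d1 d2 -> homology d1' d2'},
  forall z, fstar (homology_class d1 d2 z) = homology_class d1' d2' (map_cocycle z).
Proof.
pose rep x := projT1 (cid (@modpi_surj _ _ _ (coboundary_pred_submod d1 d2) x)).
have repK x : x = homology_class d1 d2 (rep x) by rewrite /rep; case: cid.
pose F x := homology_class d1' d2' (map_cocycle (rep x)).
have FE z : F (homology_class d1 d2 z) = homology_class d1' d2' (map_cocycle z).
  apply/modpi_eq; rewrite -linearB; apply: map_cocycle_coboundary.
  apply/(modpi_eq (coboundary_pred_submod d1 d2)); exact: esym (repK _).
have F_linear : linear F.
  move=> a x y; rewrite {1}(repK x) {1}(repK y) -linearP FE.
  by rewrite /F !linearP.
pose F1 := GRing.isLinear.Build K (homology d1 d2) (homology d1' d2') *:%R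
  F F_linear.
by exists (HB.pack F F1 : {linear homology d1 d2 -> homology d1' d2'}).
Qed.

End HomologyMap.

(** * Naturality of the Yamaguti coboundary *)

Section Intertwining.
Variables (K : fieldType) (g h : lieYamagutiType K).
Variables (psig : 'End(g)) (psih : 'End(h)).
Hypothesis psigP : is_ly_hom psig.
Hypothesis psig_inv : bijective psig.

(** An isomorphism, when psih is bijective, of (rho', mu') with (rho, mu) over
    the change of variables psig of g. *)
Definition intertwines (rho' : 'Hom(g, 'End(h))) (mu' : 'Hom(g, 'Hom(g, 'End(h))))
    (rho : 'Hom(g, 'End(h))) (mu : 'Hom(g, 'Hom(g, 'End(h)))) : Prop :=
  (forall x u, psih (rho' x u) = rho (psig x) (psih u)) /\
  (forall x y u, psih (mu' x y u) = mu (psig x) (psig y) (psih u)).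

Local Notation phi := (psig^-1)%VF.

Lemma psig_lker0 : lker psig == 0%VS.
Proof. by apply/lker0P; exact: bij_inj. Qed.

Lemma psigK : cancel psig phi.
Proof. exact: lker0_lfunK psig_lker0. Qed.

Lemma psigVK : cancel phi psig.
Proof. by apply/(bij_can_sym psig_inv); exact: psigK. Qed.

Lemma psigV_bracket x y : phi (bracket x y) = bracket (phi x) (phi y).
Proof. by apply: (can_inj psigK); rewrite psigP.1 !psigVK. Qed.

Lemma psigV_triple x y z : phi (triple x y z) = triple (phi x) (phi y) (phi z).
Proof. by apply: (can_inj psigK); rewrite psigP.2 !psigVK. Qed.

Variables (rho' rho : 'Hom(g, 'End(h))) (mu' mu : 'Hom(g, 'Hom(g, 'End(h)))).
Hypothesis inter : intertwines rho' mu' rho mu.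

Let lfE := (add_lfunE, opp_lfunE, scale_lfunE, comp_lfunE).

(** Cochains are evaluated at arguments moved by psig^-1, so the intertwining
    relations are needed in the form that removes psig^-1. *)
Lemma psih_rhoV x u : psih (rho' (phi x) u) = rho x (psih u).
Proof. by rewrite inter.1 psigVK. Qed.

Lemma psih_muV x y u : psih (mu' (phi x) (phi y) u) = mu x y (psih u).
Proof. by rewrite inter.2 !psigVK. Qed.

(** D is a noncommutative polynomial in the values of rho and mu, composed with
    the bracket of g; each of these is carried over. *)
Lemma psih_repDV x y u :
  psih (repD rho' mu' (phi x) (phi y) u) = repD rho mu x y (psih u).
Proof.
rewrite /repD /lcomm !lfE -psigV_bracket !linearD !linearN /=.
by rewrite !psih_muV !psih_rhoV.
Qed.

Lemma omit_pull n (X : 'I_n.+1 -> g * g) k :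
  omit (pull psig X) k = pull psig (omit X k).
Proof. by []. Qed.

(** X_k o X_l involves only the triple bracket of g, which psig^-1 preserves. *)
Lemma circ_pI n (f : mform g n h) (X : 'I_n.+1 -> g * g) k l :
  circ (pI psig psih f) X k l = psih (circ f (pull psig X) k l).
Proof.
by rewrite /circ /= /pI_fun -!omit_pull !pull_upd /= !psigV_triple linearD.
Qed.

Lemma circ_pII n (G : mform g n 'Hom(g, h)) (X : 'I_n.+1 -> g * g) k l z :
  circ (pII psig psih G) X k l z = psih (circ G (pull psig X) k l (phi z)).
Proof.
rewrite /circ /= /pII_fun !lfE /= -!omit_pull !pull_upd /= !psigV_triple.
by rewrite linearD.
Qed.

Lemma cobI_natural n (f : mform g n h) (G : mform g n 'Hom(g, h)) X :
  cobI_fun rho mu (pI psig psih f) (pII psig psih G) X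
  = psih (cobI_fun rho' mu' f G (pull psig X)).
Proof.
rewrite /cobI_fun !(linearD psih) !(linear_sum psih) /=; congr (_ + _ + _).
- rewrite linearZ /= !(linearB psih) /= !lfE /=; congr (_ *: _).
  by rewrite !psih_rhoV psigV_bracket.
- by apply: eq_bigr => k _; rewrite linearZ /= psih_repDV.
- apply: eq_bigr => k _; rewrite linear_sum /=; apply: eq_bigr => l _.
  by rewrite linearZ /= circ_pI.
Qed.

Lemma cobII_natural n (G : mform g n 'Hom(g, h)) X z :
  cobII_fun rho mu (pII psig psih G) X z
  = psih (cobII_fun rho' mu' G (pull psig X) (phi z)).
Proof.
rewrite /cobII_fun !(linearD psih) !(linear_sum psih) /=; congr (_ + _ + _ + _).
- by rewrite linearZ /= (linearB psih) /= !lfE /= !psih_muV.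
- by apply: eq_bigr => k _; rewrite linearZ /= psih_repDV !lfE.
- apply: eq_bigr => k _; rewrite linear_sum /=; apply: eq_bigr => l _.
  by rewrite linearZ /= circ_pII.
- by apply: eq_bigr => k _; rewrite linearZ /= !lfE psigV_triple.
Qed.

Lemma cob1I_natural (f : 'Hom(g, h)) X :
  cob1I_fun rho (psih \o f \o phi)%VF X = psih (cob1I_fun rho' f (pull psig X)).
Proof.
by rewrite /cob1I_fun !(linearB psih) /= !lfE /= !psih_rhoV psigV_bracket.
Qed.

Lemma cob1II_natural (f : 'Hom(g, h)) X z :
  cob1II_fun rho mu (psih \o f \o phi)%VF X z
  = psih (cob1II_fun rho' mu' f (pull psig X) (phi z)).
Proof.
rewrite /cob1II_fun !(linearB psih) (linearD psih) /= psih_repDV !psih_muV.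
by rewrite !comp_lfunE /= psigV_triple.
Qed.

(** The coboundary formula is natural in (g, rho, mu), summand by summand. *)
Lemma pcochain_coboundary n (c : cochain g h n.+1) :
  coboundary rho mu (pcochain psig psih c)
  = pcochain (n := n.+1) psig psih (coboundary rho' mu' c).
Proof.
case: n c => [|n] c; congr pair; apply/val_inj/funext => X /=.
- exact: cob1I_natural.
- by apply/lfunP => z; rewrite /pII_fun !lfE !lfunE /=; exact: cob1II_natural.
- exact: cobI_natural.
- by apply/lfunP => z; rewrite /pII_fun !lfE !lfunE /=; exact: cobII_natural.
Qed.

End Intertwining.

(** * Morphisms of crossed homomorphisms *)

Section CrossedMorphism.
Variables (K : fieldType) (g h : lieYamagutiType K).
Variables (rho : 'Hom(g, 'End(h))) (mu : 'Hom(g, 'Hom(g, 'End(h)))).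
Variables (H H' : 'Hom(g, h)) (psig : 'End(g)) (psih : 'End(h)).
Hypothesis psiP : is_crossed_hom_morphism rho mu H' H psig psih.
Hypothesis psig_inv : bijective psig.

(** The two terms of each of rho_H and mu_H are intertwined separately: one by
    equivariance of the action, the other because psih preserves the brackets
    of h and carries H' to H. *)
Lemma intertwines_crossed :
  intertwines psig psih (rhoH rho H') (muH mu H') (rhoH rho H) (muH mu H).
Proof.
case: psiP => _ [hb ht] HE rhoE muE; split=> *.
- by rewrite !rhoHE linearD /= hb rhoE HE.
- by rewrite !muHE linearD /= ht muE !HE.
Qed.

(** The formula for the differential of x /\ y uses only mu, H and the triple
    bracket of h, evaluated at x, y and the free argument z; moving all three by
    psig cancels the psig^-1 that p applies to z. *)
Lemma pcochain_partial0 x y :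
  pcochain (n := 0) psig psih (partial0 mu H' x y)
  = partial0 mu H (psig x) (psig y).
Proof.
case: psiP => _ [_ ht] HE _ muE; apply/lfunP => z.
rewrite /= !comp_lfunE !partial0E linearD linearB /=.
by rewrite !muE ht !HE (psigVK psig_inv).
Qed.

Lemma pcochain_differential n (c : cochain g h n.+1) :
  differential rho mu H n.+1 (pcochain psig psih c)
  = pcochain (n := n.+1) psig psih (differential rho mu H' n.+1 c).
Proof.
exact: (pcochain_coboundary (crossed_morph_g psiP) psig_inv intertwines_crossed).
Qed.

Lemma pcochain_boundary n (a : cochain g h n) :
  exists a', differential rho mu H n a'
             = pcochain psig psih (differential rho mu H' n a).
Proof.
case: n a => [|n] a; last first.
  by exists (pcochain psig psih a); exact: pcochain_differential.
(* The map induced by psig on the exterior square. *)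
exists (ext2_lift (fun x y => wedge (psig x) (psig y)) a).
rewrite [ext2_lift _ a]/ext2_lift linear_sum.
rewrite [differential rho mu H' 0 a]/(ext2_lift (partial0 mu H') a) /ext2_lift.
rewrite [RHS](linear_sum (@pcochain K g h psig psih 0)).
apply: eq_bigr => ij _; rewrite !linearZ differential0_wedge.
by congr (_ *: _); exact: esym (pcochain_partial0 _ _).
Qed.

End CrossedMorphism.

Theorem theorem4p5 (K : fieldType) (charK : [pchar K] =i pred0)
    (g h : lieYamagutiType K)
    (rho : 'Hom(g, 'End(h))) (mu : 'Hom(g, 'Hom(g, 'End(h))))
    (act : is_action rho mu)
    (H H' : 'Hom(g, h))
    (crossedH : is_crossed_hom rho mu H) (crossedH' : is_crossed_hom rho mu H')
    (psig : 'End(g)) (psih : 'End(h))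
    (psiP : is_crossed_hom_morphism rho mu H' H psig psih)
    (psig_inv : bijective psig) :
  (forall (n : nat) (c : cochain g h n.+1),
     differential rho mu H n.+1 (pcochain psig psih c)
     = pcochain psig psih (differential rho mu H' n.+1 c))
  /\
  (forall n : nat,
     exists pstar : {linear cohomology rho mu H' n.+1 -> cohomology rho mu H n.+1},
     forall z : cocycle (differential rho mu H' n.+1),
     exists2 w : cocycle (differential rho mu H n.+1),
       val w = pcochain psig psih (val z) &
       pstar (homology_class (differential rho mu H' n) (differential rho mu H' n.+1) z)
       = homology_class (differential rho mu H n) (differential rho mu H n.+1) w).
Proof.
have pd := pcochain_differential psiP psig_inv; split=> // n.
have [pstar pstarE] := homology_functorial (pcochain_boundary psiP psig_inv (n := n))
  (@pd n).
exists pstar => z; exists (map_cocycle (@pd n) z) => //; exact: pstarE.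
Qed.
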